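(* Let $x_1,\dots,x_n$ be real numbers with minimum $a$, maximum $b$, arithmetic mean $\overline x$ and variance $s^2$ ($s\ge0$). Suppose $0\le a<\overline x\le s$. Then $$s^2+\left(\frac{s^2-\overline x^2}{2\overline x}\right)^2\le\frac{(b-a)^2}{4},$$ and, if $n\ge3$, $$s^2-\frac{2}{n-2}\left(\frac{s^2-\overline x^2}{2\overline x}\right)^2\ge\frac{(b-a)^2}{2n}.$$
   Context: For real numbers $x_1,\dots,x_n$: $a=\min_i x_i$, $b=\max_i x_i$, $\overline x=\frac1n\sum_{i=1}^n x_i$, and $s^2=\frac1n\sum_{i=1}^n(x_i-\overline x)^2$ with $s\ge 0$. *)

(* Defs.v *)
From mathcomp Require Import all_boot all_order all_algebra.
From mathcomp Require Import reals.

Set Implicit Arguments.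
Unset Strict Implicit.
Unset Printing Implicit Defensive.

Import Order.TTheory GRing.Theory Num.Theory.
Local Open Scope ring_scope.

(* Minimum and maximum of a finite family are relations: the attainment clause
   forces the family to be nonempty, so no default value is needed for n = 0. *)
Definition is_minimum (R : realType) (n : nat) (x : 'I_n -> R) (a : R) : Prop :=
  (exists i, x i = a) /\ (forall i, a <= x i).

Definition is_maximum (R : realType) (n : nat) (x : 'I_n -> R) (b : R) : Prop :=
  (exists i, x i = b) /\ (forall i, x i <= b).

Definition mean (R : realType) (n : nat) (x : 'I_n -> R) : R :=
  (\sum_(i < n) x i) / n%:R.

(* Normalized by 1/n, not 1/(n-1). *)
Definition variance (R : realType) (n : nat) (x : 'I_n -> R) : R :=
  (\sum_(i < n) (x i - mean x) ^+ 2) / n%:R.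

(* Main.v *)
Require Import Defs.
From mathcomp Require Import all_boot all_order all_algebra.
From mathcomp Require Import reals.
From mathcomp Require Import ring lra.

(** Write [m] for the mean, [u = m - a] and [v = b - m], so that
    [0 < u <= m <= s] (this is where [0 <= a] enters) and [b - a = u + v].

    Both inequalities come from two general bounds on the variance. From above,
    [s^2 <= u v] ([variance_le_mul]). From below, a sample containing [a] and
    [b] has the least variance when the other [n - 2] values coincide, whence
    [s^2 >= (b - a)^2 / (2 n) + (v - u)^2 / (2 (n - 2))] ([variance_ge_pair]).

    The upper bound gives [v >= s^2 / u]. Since [t + s^2 / t] decreases for
    [0 < t <= s] ([add_div_le]), comparing its values at [m] and [u] yields
    [m + s^2 / m <= u + s^2 / u <= u + v].
    Put [d = (s^2 - m^2) / (2 m)], the quantity squared in both claims. The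
    first claim is the square of this inequality, because
    [s^2 + d^2 = ((s^2 + m^2) / (2 m))^2]. Subtracting [2 m >= 2 u] from it gives
    [0 <= 2 d = s^2 / m - m <= v - u], and with this the lower bound on the
    variance becomes the second claim. *)

Set Implicit Arguments.
Unset Strict Implicit.
Unset Printing Implicit Defensive.

Import Order.TTheory GRing.Theory Num.Theory.
Local Open Scope ring_scope.

Lemma sum_sub_mean (R : realType) (n : nat) (x : 'I_n -> R) :
  (0 < n)%N -> \sum_(i < n) (x i - mean x) = 0.
Proof.
move=> n_gt0; rewrite sumrB sumr_const card_ord -mulr_natr /mean divfK ?subrr //.
by rewrite pnatr_eq0 -lt0n.
Qed.

Lemma sum_sqr_sub_mean (R : realType) (n : nat) (x : 'I_n -> R) :
  (0 < n)%N -> \sum_(i < n) (x i - mean x) ^+ 2 = n%:R * variance x.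
Proof.
by move=> n_gt0; rewrite /variance mulrC divfK // pnatr_eq0 -lt0n.
Qed.

(** The Bhatia-Davis inequality: the products [(b - x i) * (x i - a)] are
    nonnegative, and their average is [(b - m) * (m - a)] minus the variance. *)
Lemma variance_le_mul (R : realType) (n : nat) (x : 'I_n -> R) (a b : R) :
    (0 < n)%N -> (forall i, a <= x i) -> (forall i, x i <= b) ->
  variance x <= (b - mean x) * (mean x - a).
Proof.
move=> n_gt0 ax xb.
have n0 : 0 < n%:R :> R by rewrite ltr0n.
have prod_ge0 : 0 <= \sum_(i < n) (b - x i) * (x i - a).
  by apply: sumr_ge0 => i _; rewrite mulr_ge0 ?subr_ge0.
rewrite -(ler_pM2l n0) -sum_sqr_sub_mean // -subr_ge0.
suff <- : \sum_(i < n) (b - x i) * (x i - a) =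
    n%:R * ((b - mean x) * (mean x - a)) - \sum_(i < n) (x i - mean x) ^+ 2 by [].
rewrite (eq_bigr (fun i => (b - mean x) * (mean x - a)
    + (a + b - 2 * mean x) * (x i - mean x) - (x i - mean x) ^+ 2)); last first.
  by move=> i _; ring.
rewrite sumrB big_split /= sumr_const card_ord -mulr_sumr sum_sub_mean //.
by rewrite mulr0 addr0 mulr_natl.
Qed.

(** The squares [(x k - m + c)^2] sum to [n * (variance x + c^2)] over all [k],
    so any two of them are together at most that; the free shift [c] lets the
    discarded terms vanish when they are all equal. *)
Lemma sum_sqr_shift_pair_le (R : realType) (n : nat) (x : 'I_n -> R)
    (i j : 'I_n) (c : R) : i != j ->
  (x i - mean x + c) ^+ 2 + (x j - mean x + c) ^+ 2
    <= n%:R * (variance x + c ^+ 2).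
Proof.
move=> neq_ij; have n_gt0 : (0 < n)%N by apply: leq_ltn_trans (ltn_ord i).
have <- : \sum_(k < n) (x k - mean x + c) ^+ 2 = n%:R * (variance x + c ^+ 2).
  rewrite (eq_bigr (fun k => (x k - mean x) ^+ 2 + (2 * c) * (x k - mean x)
    + c ^+ 2)); last by move=> k _; ring.
  rewrite !big_split /= -mulr_sumr sum_sub_mean // mulr0 addr0.
  by rewrite sum_sqr_sub_mean // sumr_const card_ord mulrDr [_ * c ^+ 2]mulr_natl.
rewrite (bigD1 i) //= (bigD1 j) 1?eq_sym //= addrA lerDl.
by apply: sumr_ge0 => k _; exact: sqr_ge0.
Qed.

(** With two sample values prescribed, the variance is least when all the
    others are equal to the value that the mean imposes. *)
Lemma variance_ge_pair (R : realType) (n : nat) (x : 'I_n -> R) (i j : 'I_n) :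
    (2 < n)%N -> i != j ->
  (x j - x i) ^+ 2 / (2 * n%:R)
    + (x i + x j - 2 * mean x) ^+ 2 / (2 * (n%:R - 2)) <= variance x.
Proof.
move=> n_gt2 neq_ij.
have n0 : 2 < n%:R :> R by rewrite ltr_nat.
set m := mean x; set N := n%:R in n0 *.
(* The remaining deviations sum to minus those of i and j; the shift c
   cancels their average. *)
pose c := (x i + x j - 2 * m) / (N - 2).
have := sum_sqr_shift_pair_le x c neq_ij; rewrite -/m -/N => pair_le.
have N_neq0 : N != 0 by lra.
have N2_neq0 : N - 2 != 0 by lra.
have cE : (N - 2) * c = x i + x j - 2 * m by rewrite mulrC divfK.
have N_gt0 : 0 < N by lra.
rewrite -(ler_pM2l N_gt0).
have -> : N * ((x j - x i) ^+ 2 / (2 * N)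
      + (x i + x j - 2 * m) ^+ 2 / (2 * (N - 2)))
    = (x i - m + c) ^+ 2 + (x j - m + c) ^+ 2 - N * c ^+ 2.
  by rewrite /c; field; rewrite N_neq0 N2_neq0.
by rewrite lerBlDr -mulrDr.
Qed.

(** [t + q / t] decreases as long as [t^2 <= q]. *)
Lemma add_div_le (R : realType) (q u m : R) :
  0 < u -> u <= m -> m ^+ 2 <= q -> m + q / m <= u + q / u.
Proof.
move=> u0 um mq; have m0 : 0 < m by lra.
rewrite -subr_ge0.
have -> : u + q / u - (m + q / m) = (m - u) * (q - u * m) / (u * m).
  by field; rewrite !gt_eqF.
apply: divr_ge0; last by rewrite mulr_ge0 ?ltW.
by apply: mulr_ge0; [lra | nra].
Qed.

Theorem theorem2p4 (R : realType) (n : nat) (x : 'I_n -> R) (a b s : R)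
  (ha : is_minimum x a) (hb : is_maximum x b)
  (hs0 : 0 <= s) (hs : s ^+ 2 = variance x)
  (ha0 : 0 <= a) (ham : a < mean x) (hms : mean x <= s) :
  s ^+ 2 + ((s ^+ 2 - mean x ^+ 2) / (2 * mean x)) ^+ 2 <= (b - a) ^+ 2 / 4
  /\
  ((3 <= n)%N ->
   s ^+ 2 - 2 / (n%:R - 2) * ((s ^+ 2 - mean x ^+ 2) / (2 * mean x)) ^+ 2
     >= (b - a) ^+ 2 / (2 * n%:R)).
Proof.
have [[i xi] ax] := ha; have [[j xj] xb] := hb.
have n_gt0 : (0 < n)%N by apply: leq_ltn_trans (ltn_ord i).
have := variance_le_mul n_gt0 ax xb; rewrite -hs.
move: (@variance_ge_pair R n x i j); rewrite -hs xi xj.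
move: (mean x) ham hms => m ham hms var_ge var_le.
have u0 : 0 < m - a by lra.
have m0 : 0 < m by lra.
have m2_le : m ^+ 2 <= s ^+ 2 by rewrite lerXn2r ?nnegrE // ltW.
have v_ge : s ^+ 2 / (m - a) <= b - m by rewrite ler_pdivrMr.
have um : m - a <= m by lra.
have add_le := add_div_le u0 um m2_le.
have sum_le : m + s ^+ 2 / m <= b - a by lra.
set d := _ / (2 * m).
have dE : 2 * d = s ^+ 2 / m - m by rewrite /d; field; rewrite gt_eqF.
have d0 : 0 <= d by rewrite /d divr_ge0 ?subr_ge0 // mulr_ge0 // ltW.
have d_le : 2 * d <= a + b - 2 * m by lra.
split.
  have -> : s ^+ 2 + d ^+ 2 = (m + s ^+ 2 / m) ^+ 2 / 4.
    by rewrite /d; field; rewrite gt_eqF.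
  rewrite ler_pM2r ?invr_gt0 ?ltr0n // lerXn2r ?nnegrE //; last by lra.
  by rewrite addr_ge0 ?divr_ge0 ?sqr_ge0 ?ltW.
move=> n_gt2; have n0 : 2 < n%:R :> R by rewrite ltr_nat.
(* If a and b sat at the same index, then b = a < m would contradict v_ge. *)
have neq_ij : i != j.
  apply/eqP => ij; have ab : a = b by rewrite -xi -xj ij.
  have : 0 <= s ^+ 2 / (m - a) by rewrite divr_ge0 ?sqr_ge0 ?ltW.
  lra.
rewrite lerBrDr; apply: le_trans (var_ge n_gt2 neq_ij); rewrite lerD2l.
have -> : 2 / (n%:R - 2) * d ^+ 2 = (2 * d) ^+ 2 / (2 * (n%:R - 2)).
  by field; rewrite gt_eqF // subr_gt0.
rewrite ler_pM2r ?invr_gt0 ?mulr_gt0 ?subr_gt0 ?ltr0n //.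
by rewrite lerXn2r ?nnegrE //; lra.
Qed.
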